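(* Let $R$ be an uncountable range set. If $(X,d)$ and $(Y,e)$ are $R$-petaloid ultrametric spaces, then $(X,d)$ and $(Y,e)$ are isometric to each other. Namely, an $R$-petaloid ultrametric space is unique up to isometry.
   Context: A range set is a subset $R\subseteq[0,\infty)$ with $0\in R$. An ultrametric is a metric $d$ with $d(x,y)\le \max\{d(x,z),d(z,y)\}$ for all $x,y,z$. An ultrametric $d$ on a set $X$ is $R$-valued (an $R$-ultrametric) if $d(x,y)\in R$ for all $x,y\in X$. A subset $E\subseteq[0,\infty)$ is semi-sporadic if there is a strictly decreasing sequence $\{a_i\}_{i\in\mathbb{Z}_{\ge 0}}$ in $(0,\infty)$ with $\lim_{i\to\infty} a_i=0$ and $E=\{0\}\cup\{a_i\mid i\in\mathbb{Z}_{\ge0}\}$. A subset of $[0,\infty)$ is tenuous if it is finite or semi-sporadic. $\mathrm{TEN}(R)$ denotes the set of all tenuous subsets $S\subseteq R$ with $0\in S$. For a metric space $(X,d)$, $x\in X$ and $A\subseteq X$, put $d(x,A)=\inf_{a\in A}d(x,a)$; restrictions of a metric to subsets are denoted by the same symbol. For a range set $S$, $\mathscr{N}(S)$ is the class of all finite $S$-valued ultrametric spaces. For a class $\mathscr{C}$ of metric spaces, a metric space $(X,d)$ is $\mathscr{C}$-injective if for all $(A,a),(B,b)\in\mathscr{C}$ and all isometric embeddings $\phi:(A,a)\to(B,b)$, $\psi:(A,a)\to(X,d)$ there is an isometric embedding $\theta:(B,b)\to(X,d)$ with $\theta\circ\phi=\psi$. For a countable (possibly finite) range set $S$, the $S$-Urysohn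 universal ultrametric space is the non-empty separable complete $\mathscr{N}(S)$-injective $S$-valued ultrametric space, which is unique up to isometry. For an uncountable range set $R$, a metric space $(X,d)$ is $R$-petaloid if it is an $R$-valued ultrametric space and there is a family $\{\Pi(X,S)\}_{S\in\mathrm{TEN}(R)}$ of subspaces of $X$ (called an $R$-petal of $X$) such that: (P1) for every $S\in\mathrm{TEN}(R)$, $(\Pi(X,S),d)$ is isometric to the $S$-Urysohn universal ultrametric space; (P2) $\bigcup_{S\in\mathrm{TEN}(R)}\Pi(X,S)=X$; (P3) $\Pi(X,S)\cap\Pi(X,T)=\Pi(X,S\cap T)$ for all $S,T\in\mathrm{TEN}(R)$; (P4) if $S,T\in\mathrm{TEN}(R)$ and $x\in\Pi(X,T)$, then $d(x,\Pi(X,S))\in(T\setminus S)\cup\{0\}$. *)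

(* Defs.v *)
From HB Require Import structures.
From mathcomp Require Import all_boot all_order all_algebra.
From mathcomp Require Import all_classical all_reals all_analysis.

Set Implicit Arguments.
Unset Strict Implicit.
Unset Printing Implicit Defensive.

Import Order.TTheory GRing.Theory Num.Theory.
Import numFieldNormedType.Exports.

Local Open Scope classical_set_scope.
Local Open Scope ring_scope.

(* The library gives [set_type A] the induced topology, uniformity and balls;
   this adds the restricted distance. *)
Section restricted_metric.
Context {K : realType} {X : metricType K} (A : set X).

Let rdist (x y : set_type A) : K := mdist (set_val x) (set_val y).

Let rdist_ge0 x y : 0 <= rdist x y.
Proof. exact: mdist_ge0. Qed.

Let rdist_positivity x y : rdist x y = 0 -> x = y.
Proof. by move=> /mdist_positivity /val_inj. Qed.

Let ballErdist x r : ball x r = [set y | rdist x y < r].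
Proof. by rewrite -initial_ballE ballEmdist. Qed.

HB.instance Definition _ := PseudoMetric_isMetric.Build K (set_type A)
  rdist_ge0 rdist_positivity ballErdist.

End restricted_metric.

Definition metric_subspace (K : realType) (X : metricType K) (A : set X) :
  metricType K := Metric.clone K (set_type A) _.

Definition range_set (K : realType) (R : set K) : Prop :=
  (R `<=` [set r | 0 <= r]) /\ R 0.

Definition semi_sporadic (K : realType) (E : set K) : Prop :=
  exists a : nat -> K,
    [/\ forall i, 0 < a i, decreasing_seq a, a @ \oo --> (0 : K)
      & E = [set 0] `|` range a].

Definition tenuous (K : realType) (E : set K) : Prop :=
  (E `<=` [set r | 0 <= r]) /\ (finite_set E \/ semi_sporadic E).

Definition TEN (K : realType) (R : set K) : set (set K) :=
  [set S | [/\ tenuous S, S `<=` R & S 0]].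

Definition ultrametric (K : realType) (X : metricType K) : Prop :=
  forall x y z : X, mdist x y <= Num.max (mdist x z) (mdist z y).

Definition valued_in (K : realType) (R : set K) (X : metricType K) : Prop :=
  forall x y : X, R (mdist x y).

Definition isometric_embedding (K : realType) (X Y : metricType K)
  (f : X -> Y) : Prop := forall x y, mdist (f x) (f y) = mdist x y.

Definition isometric (K : realType) (X Y : metricType K) : Prop :=
  exists2 f : X -> Y, isometric_embedding f & bijective f.

Definition finite_ultrametric_class (K : realType) (S : set K)
  (X : metricType K) : Prop :=
  [/\ finite_set [set: X], ultrametric X & valued_in S X].

Definition injective_for (K : realType) (C : metricType K -> Prop)
  (X : metricType K) : Prop :=
  forall A B : metricType K, C A -> C B ->
  forall (phi : A -> B) (psi : A -> X),
    isometric_embedding phi -> isometric_embedding psi ->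
  exists2 theta : B -> X, isometric_embedding theta & theta \o phi = psi.

Definition separable (K : realType) (X : metricType K) : Prop :=
  exists2 D : set X, countable D & dense D.

(* The library's [completeType] requires a distinguished point, which an
   abstract metric space lacks. *)
Definition complete_metric (K : realType) (X : metricType K) : Prop :=
  forall u : nat -> X, cauchy (u @ \oo) -> exists l : X, u @ \oo --> l.

Definition urysohn_universal (K : realType) (S : set K) (U : metricType K) :
  Prop :=
  [/\ [set: U] !=set0, separable U & complete_metric U] /\
  [/\ injective_for (finite_ultrametric_class S) U, ultrametric U
    & valued_in S U].

(* [inf] is the genuine infimum here only because A will be nonempty;
   [inf set0] is 0. *)
Definition dist_to_set (K : realType) (X : metricType K) (x : X) (A : set X) :
  K := inf [set mdist x a | a in A].

(* [Pi] is total on [set K], but only its values on [TEN R] are constrained;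
   [TEN R] is closed under intersection, so this also covers [Pi (S `&` T)]. *)
Definition petal (K : realType) (R : set K) (X : metricType K)
  (Pi : set K -> set X) : Prop :=
  [/\ forall S, TEN R S ->
        exists2 U : metricType K,
          urysohn_universal S U & isometric (metric_subspace (Pi S)) U,
      \bigcup_(S in TEN R) Pi S = [set: X],
      forall S T, TEN R S -> TEN R T -> Pi S `&` Pi T = Pi (S `&` T)
    & forall S T x, TEN R S -> TEN R T -> Pi T x ->
        ((T `\` S) `|` [set 0]) (dist_to_set x (Pi S))].

Definition petaloid (K : realType) (R : set K) (X : metricType K) : Prop :=
  [/\ ultrametric X, valued_in R X & exists Pi : set K -> set X, petal R Pi].

(* Main.v *)
Require Import Defs.
From HB Require Import structures.
From mathcomp Require Import all_boot all_order all_algebra.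
From mathcomp Require Import all_classical all_reals all_analysis.

Set Implicit Arguments.
Unset Strict Implicit.
Unset Printing Implicit Defensive.

Import Order.TTheory GRing.Theory Num.Theory.
Import numFieldNormedType.Exports.

Local Open Scope classical_set_scope.
Local Open Scope ring_scope.

(** A petaloid space admits coordinates in which nothing is left to choose, so
any two such spaces over the same range set are isometric.

Fix r > 0 in R. In an ultrametric space, the points of a closed ball C of
radius r split into open balls of radius r, the branches of C; two points of C
are in the same branch iff their distance is less than r. In a petaloid space
the branches of every C have the same structure:
- they are countably infinite in number. Some petal with a finite range set
  containing r meets C ([branch_center]), and by (P4) it then meets every branch
  of C; that petal is separable, so there are at most countably many branches,
  and injectivity puts arbitrarily many points of C at mutual distance r in it,
  so there are infinitely many;
- exactly one of them is distinguished, the one containing the points that lie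
  in some petal whose range set omits r. By (P4) such points exist in C
  ([null_center]) and cannot be at distance exactly r from each other
  ([null_close]).
So the branches of C can be numbered bijectively by the natural numbers, the
distinguished one getting 0 ([petal_labelling]).

Let Phi x t be the number of the branch containing x inside the closed ball of
radius t around x, and 0 if t is not a positive element of R. The distance of x
and y is the last scale at which Phi x and Phi y differ, and the functions
Phi x are exactly the functions whose support is made of positive elements of
a tenuous subset of R ([labelling_coding]). The support of Phi x is in T when x
is in the petal of T, because at each other scale x is in the distinguished
branch. Conversely, a function with finite support is reached by starting at
the one-point petal of {0} and correcting the values from the largest scale
down to the smallest: the branch prescribed at the scale a is reached by moving
a distance at most a, hence without changing the values at larger scales, and
(P4) moves the new point into the right petal without leaving the branch. A
general tenuous support is finite above every positive scale, so completeness
of the petal provides the point as a limit. Since this description of Phi does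
not mention the space, matching equal functions is an isometry
([coding_isometric]). *)

(** * Equidistant spaces *)

Definition equidistant (K : realType) (r : {posnum K}) (n : nat) : Type := 'I_n.

Section equidistant_metric.
Context {K : realType} (r : {posnum K}) (n : nat).
Implicit Types i j k : equidistant r n.

HB.instance Definition _ := Choice.copy (equidistant r n) 'I_n.

Let edist i j : K := if i == j then 0 else r%:num.

Let edistxx i : edist i i = 0.
Proof. by rewrite /edist eqxx. Qed.

Let edist_positivity i j : edist i j = 0 -> i = j.
Proof. by rewrite /edist; case: eqP => // _ /eqP; rewrite gt_eqF. Qed.

Let edist_sym i j : edist i j = edist j i.
Proof. by rewrite /edist eq_sym. Qed.

Let edist_triangle j i k : edist i k <= edist i j + edist j k.
Proof.
rewrite /edist; have r0 : 0 <= r%:num :> K by [].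
case: (eqVneq i k) => [_|ik]; first by rewrite addr_ge0//; case: ifP.
case: (eqVneq i j) => [<-|ij]; first by rewrite (negbTE ik) add0r.
by rewrite lerDl; case: ifP.
Qed.

HB.instance Definition _ := isMetric.Build K (equidistant r n)
  edistxx edist_positivity edist_sym edist_triangle.

Lemma equidistantE i j : mdist i j = if i == j then 0 else r%:num.
Proof. by []. Qed.

Lemma equidistant_class (S : set K) : S 0 -> S r%:num ->
  finite_ultrametric_class S (equidistant r n).
Proof.
move=> S0 Sr; split.
- exact: (@finite_finset 'I_n).
- move=> i j k; rewrite !equidistantE.
  have r0 : 0 <= r%:num :> K by [].
  case: (eqVneq i j) => [_|ij]; first
    by rewrite le_max; case: ifP; rewrite ?lexx ?r0.
  case: (eqVneq i k) => [<-|ik]; last by rewrite le_max lexx.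
  by rewrite (negbTE ij) le_max lexx orbT.
- by move=> i j; rewrite equidistantE; case: ifP.
Qed.

End equidistant_metric.

(** * Ultrametric inequalities *)

Section ultrametric_lemmas.
Context {K : realType} {X : metricType K} (X_ultra : ultrametric X).
Implicit Types (x y z : X) (r : K).

Lemma ultra_le r x y z : mdist x y <= r -> mdist y z <= r -> mdist x z <= r.
Proof. by move=> xy yz; rewrite (le_trans (X_ultra x z y))// ge_max xy. Qed.

Lemma ultra_lt r x y z : mdist x y < r -> mdist y z < r -> mdist x z < r.
Proof. by move=> xy yz; rewrite (le_lt_trans (X_ultra x z y))// gt_max xy. Qed.

Lemma ultra_isosceles x y z : mdist x y < mdist y z -> mdist x z = mdist y z.
Proof.
move=> xyz; apply/eqP; rewrite eq_le (ultra_le (ltW xyz))//=.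
rewrite leNgt; apply/negP => xz.
by have := ultra_lt (z := z) (_ : mdist y x < mdist y z) xz; 
  rewrite ltxx metric_sym => /(_ xyz).
Qed.

End ultrametric_lemmas.

(** * Subspaces isometric to an Urysohn space *)

Lemma isometric_subspaceP (K : realType) (X U : metricType K) (A : set X) :
  isometric (metric_subspace A) U ->
  exists2 g : U -> X, isometric_embedding g & range g = A.
Proof.
move=> [f fiso [g fg gf]]; exists (fun u => set_val (g u)).
  by move=> u v; rewrite -[in RHS](gf u) -[in RHS](gf v) fiso.
apply/seteqP; split => [_ [u _ <-]|x Ax]; first exact: set_valP.
pose a : metric_subspace A := SigSub (mem_set Ax).
by exists (f a) => //; rewrite fg.
Qed.

Section urysohn_subspace.
Context {K : realType} {X U : metricType K} {S : set K} {A : set X}.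
Context (U_urysohn : urysohn_universal S U).
Context (g : U -> X) (g_iso : isometric_embedding g) (gA : range g = A).

Let gP x : A x -> exists u, g u = x.
Proof. by rewrite -gA => -[u _ <-]; exists u. Qed.

Let Ag u : A (g u).
Proof. by rewrite -gA; exists u. Qed.

Lemma urysohn_subspace_neq0 : A !=set0.
Proof. by have [[[u _] _ _] _] := U_urysohn; exists (g u). Qed.

Lemma urysohn_subspace_valued x y : A x -> A y -> S (mdist x y).
Proof.
by have [_ [_ _ US]] := U_urysohn => /gP[u <-] /gP[v <-]; rewrite g_iso.
Qed.

(** Unlike density in the subspace topology, this form speaks of distances in
the ambient space only. *)
Lemma urysohn_subspace_separable : exists2 D : set X, countable D &
  D `<=` A /\ forall x (e : K), A x -> 0 < e -> exists2 y, D y & mdist x y < e.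
Proof.
have [[_ [D cD dD] _] _] := U_urysohn.
exists (g @` D); first exact: sub_countable (card_image_le _ _) cD.
split => [_ [u _ <-]//|_ e /gP[u <-] e0].
have [] := dD (ball u e)°.
- by exists u; apply: nbhs_singleton; apply: nbhs_interior; exact: nbhsx_ballx.
- exact: open_interior.
- move=> v [/interior_subset + Dv]; rewrite ballEmdist /= => uv.
  by exists (g v); rewrite ?g_iso//; exists v.
Qed.

(** The ultrametric inequality makes the Cauchy modulus also bound the distance
to the limit, with no loss. *)
Lemma urysohn_subspace_complete (u : nat -> X) : (forall n, A (u n)) ->
  (forall n m, (n <= m)%N -> mdist (u n) (u m) <= n.+1%:R^-1) ->
  exists2 x, A x & forall n, mdist (u n) x <= n.+1%:R^-1.
Proof.
have [[_ _ Ucomplete] [_ Uultra _]] := U_urysohn.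
move=> Au u_cauchy; have /choice[v gv] := fun n => gP (Au n).
have v_cauchy n m : (n <= m)%N -> mdist (v n) (v m) <= n.+1%:R^-1.
  by rewrite -g_iso !gv; exact: u_cauchy.
have [|l vl] := Ucomplete v.
  apply: cauchy_exP => e e0.
  have [k] := ltr_add_invr e0; rewrite add0r => ke.
  exists (v k); exists k => // m /= km.
  by rewrite ballEmdist /= (le_lt_trans (v_cauchy _ _ km)).
exists (g l) => // n; rewrite -gv g_iso.
have := @metricType_numDomainType.cvgr_dist_lt _ _ _ _ _ v l vl n.+1%:R^-1.
rewrite invr_gt0 ltr0n => /(_ _ isT)[N _ HN].
apply: (ultra_le Uultra (v_cauchy _ _ (leq_maxl n N))).
by rewrite metric_sym ltW// HN//= leq_maxr.
Qed.

(** The only consequence of injectivity that is used: the inclusion of one point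
into a finite equidistant space extends to the whole equidistant space. *)
Lemma urysohn_subspace_equidistant r x n : S 0 -> S r -> 0 < r -> A x ->
  exists e : 'I_n.+1 -> X, [/\ e ord0 = x, forall i, A (e i) &
    forall i j, i != j -> mdist (e i) (e j) = r].
Proof.
move=> S0 Sr r0 /gP[u <-]; have [_ [Uinj _ _]] := U_urysohn.
pose rp := PosNum r0.
have [||h h_iso hE] := Uinj (equidistant rp 1) (equidistant rp n.+1)
  (equidistant_class 1 S0 (Sr : S rp%:num))
  (equidistant_class n.+1 S0 (Sr : S rp%:num)) (fun=> ord0) (fun=> u).
- by move=> i j; rewrite !mdistxx (ord1 i) (ord1 j) mdistxx.
- by move=> i j; rewrite !mdistxx (ord1 i) (ord1 j) mdistxx.
exists (g \o h); split => //=.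
- by have /(congr1 (@^~ ord0)) /= -> := hE.
- by move=> i j ij; rewrite g_iso h_iso equidistantE (negbTE ij).
Qed.

End urysohn_subspace.

(** * Tenuous sets *)

Lemma tenuous_finite_ge (K : realType) (T : set K) (r : K) :
  tenuous T -> 0 < r -> finite_set (T `&` [set t | r <= t]).
Proof.
move=> [_ [finT|[a [_ _ a0 ->]]]] r0; first exact: finite_setIl.
have [N _ aN] : \forall n \near \oo, a n < r.
  exact: (cvgr_lt _ a0 _ r0).
apply: (@sub_finite_set _ _ (a @` `I_N)); last exact/finite_image/finite_II.
move=> t [[->|[n _ <-]]] /= rt; first by rewrite leNgt r0 in rt.
exists n => //=; rewrite ltnNge; apply/negP => Nn.
by have := aN n Nn; rewrite ltNge rt.
Qed.

(** A distance with values in the finite set F that is known only up to an error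
below the gap is bounded by r itself. *)
Lemma finite_set_gap (K : realType) (F : set K) (r : K) : finite_set F ->
  exists2 d, r < d & forall t, F t -> t < d -> t <= r.
Proof.
move=> /finite_seqP[s ->]; elim: s => [|a s [d rd sd]].
  by exists (r + 1) => //; rewrite ltrDl.
have [ar|ra] := leP a r.
- exists d => // t; rewrite /= inE => /orP[/eqP ->//|]; exact: sd.
- exists (Num.min a d) => [|t]; first by rewrite lt_min ra.
  rewrite /= inE lt_min => /orP[/eqP ->|ts] /andP[ta td]; last exact: sd.
  by rewrite ltxx in ta.
Qed.

Lemma finite_TEN (K : realType) (R F : set K) : range_set R ->
  finite_set F -> F `<=` R -> F 0 -> TEN R F.
Proof.
move=> [R_ge0 _] finF FR F0; split => //; split; last by left.
by move=> t /FR /R_ge0.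
Qed.

(** * Branches of a closed ball *)

Definition cball {K : realType} {X : metricType K} (r : K) (x : X) : set X :=
  [set y | mdist x y <= r].

Definition oball {K : realType} {X : metricType K} (r : K) (x : X) : set X :=
  [set y | mdist x y < r].

(** A bijective numbering of the branches of C by the natural numbers, presented
as a function of the points of C; N is the set of points whose branch is to
be numbered 0. *)
Definition branch_labelling (K : realType) (X : metricType K) (r : K)
    (N : set X) (C : set X) (l : X -> nat) : Prop :=
  [/\ forall y z, C y -> C z -> l y = l z <-> mdist y z < r,
      forall n, exists2 z, C z & l z = n
    & forall y, C y -> N y -> l y = 0%N].

Section balls.
Context {K : realType} {X : metricType K} (X_ultra : ultrametric X).
Implicit Types (x y z : X) (r : K).

Lemma oball_eqP r y z : 0 < r -> oball r y = oball r z <-> mdist y z < r.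
Proof.
move=> r0; split => [yz|yz].
  by have : oball r z z; [rewrite /oball /= mdistxx|rewrite -yz].
apply/seteqP; split => t; apply: (ultra_lt X_ultra) => //.
by rewrite metric_sym.
Qed.

Lemma cball_eq r y z : mdist y z <= r -> cball r y = cball r z.
Proof.
move=> yz; apply/seteqP; split => t; apply: (ultra_le X_ultra) => //.
by rewrite metric_sym.
Qed.

(** A countably infinite set of branches has a bijective numbering, and
exchanging two numbers gives 0 to the branch of w, which is the only one that N meets. *)
Lemma branch_labelling_exists r (N C : set X) w : 0 < r ->
  countable (oball r @` C) -> infinite_set (oball r @` C) ->
  C w -> (forall y, C y -> N y -> mdist y w < r) ->
  exists l, branch_labelling r N C l.
Proof.
move=> r0 cB iB Cw Nw.
have /card_set_bijP[f [_ finj fsurj]] := eq_card_nat cB iB.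
pose k := f (oball r w).
pose swap n := if n == k then 0%N else if n == 0%N then k else n.
have swapK : involutive swap.
  move=> n; rewrite /swap; have [->|nk] := eqVneq n k.
    by rewrite eqxx; case: eqVneq.
  have [->|n0] := eqVneq n 0%N; first by rewrite eqxx.
  by rewrite (negbTE nk) (negbTE n0).
(* The number k of the branch of w is exchanged with 0. *)
exists (fun y => swap (f (oball r y))); split.
- move=> y z Cy Cz; rewrite -oball_eqP//; split => [|->//].
  by move=> /(can_inj swapK); apply: finj; rewrite inE; [exists y|exists z].
- move=> n; have [_ [y Cy <-] fy] := fsurj (swap n) I.
  by exists y; rewrite // fy swapK.
- move=> y Cy Ny; have /oball_eqP -> // := Nw y Cy Ny.
  by rewrite /swap eqxx.
Qed.

Lemma infinite_branches r (C : set X) : 0 < r ->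
  (forall n, exists e : 'I_n.+1 -> X, (forall i, C (e i)) /\
     forall i j, i != j -> mdist (e i) (e j) = r) ->
  infinite_set (oball r @` C).
Proof.
move=> r0 eC /finite_seqP[s Bs]; have [e [Ce e_r]] := eC (size s).
have : (size [seq oball r (e i) | i : 'I_(size s).+1] <= size s)%N.
  apply: uniq_leq_size => [|_ /mapP[i _ ->]].
    rewrite map_inj_uniq ?enum_uniq// => i j /(oball_eqP _ _ r0) eij.
    by apply/eqP; apply: contraTT isT => /e_r eijr; rewrite eijr ltxx in eij.
  by have : (oball r @` C) (oball r (e i)) by [exists (e i)|]; rewrite Bs.
by rewrite size_map size_enum_ord ltnn.
Qed.

End balls.

(** * The branches of a petaloid space *)

(** The points that some petal witnesses not to use the scale r. *)
Definition null (K : realType) (R : set K) (X : metricType K)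
    (Pi : set K -> set X) (r : K) : set X :=
  [set x | exists T, [/\ TEN R T, ~ T r & Pi T x]].

Section petals.
Context {K : realType} {R : set K} (R_range : range_set R) {X : metricType K}.
Context (X_ultra : ultrametric X).
Context (Pi : set K -> set X) (Pi_petal : petal R Pi).
Implicit Types (S T : set K) (x y z : X) (r t : K).
Local Notation null := (null R Pi).

Let petal_urysohn S : TEN R S -> exists (U : metricType K) (g : U -> X),
  [/\ urysohn_universal S U, isometric_embedding g & range g = Pi S].
Proof.
move=> tS; have [H _ _ _] := Pi_petal.
have [U US /isometric_subspaceP[g ? ?]] := H S tS.
by exists U, g.
Qed.

Lemma petal_neq0 S : TEN R S -> Pi S !=set0.
Proof.
by move=> /petal_urysohn[U [g [US _ gS]]]; exact: (urysohn_subspace_neq0 US gS).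
Qed.

Lemma petal_valued S x y : TEN R S -> Pi S x -> Pi S y -> S (mdist x y).
Proof.
move=> /petal_urysohn[U [g [US g_iso gS]]].
exact: (urysohn_subspace_valued US g_iso gS).
Qed.

Lemma petal_complete S (u : nat -> X) : TEN R S -> (forall n, Pi S (u n)) ->
  (forall n m, (n <= m)%N -> mdist (u n) (u m) <= n.+1%:R^-1) ->
  exists2 x, Pi S x & forall n, mdist (u n) x <= n.+1%:R^-1.
Proof.
move=> /petal_urysohn[U [g [US g_iso gS]]].
exact: (urysohn_subspace_complete US g_iso gS).
Qed.

Lemma petal_cover x : exists2 T, TEN R T & Pi T x.
Proof.
by have [_ H _ _] := Pi_petal; have [] : (\bigcup_(S in TEN R) Pi S) x; 
  [rewrite H | move=> T; exists T].
Qed.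

Lemma petalS S T : TEN R S -> TEN R T -> S `<=` T -> Pi S `<=` Pi T.
Proof.
have [_ _ H _] := Pi_petal => tS tT /setIidl ST x.
by rewrite -ST -H// => -[].
Qed.

(** The form in which (P4) is used. The distance of x to the petal of S is 0 or
an element of T outside S, so it is less than r as soon as each other value at
least r is excluded, either because it is in S or because a point of the petal
is closer. *)
Lemma petal_approach S T x r : TEN R S -> TEN R T -> Pi T x -> 0 < r ->
  (forall t, r <= t -> T t -> S t \/ exists2 y, Pi S y & mdist x y < t) ->
  exists2 y, Pi S y & mdist x y < r.
Proof.
move=> tS tT Tx r0 TS; set D := [set mdist x a | a in Pi S].
have lbD : has_lbound D by exists 0 => _ [y _ <-]; exact: mdist_ge0.
have D0 : D !=set0.
  by have [y Sy] := petal_neq0 tS; exists (mdist x y), y.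
have Dr : inf D < r.
  rewrite ltNge; apply/negP => rD.
  have [_ _ _ P4] := Pi_petal; have := P4 S T x tS tT Tx.
  rewrite /dist_to_set -/D => -[[TD SD]|/= D00]; last first.
    by rewrite D00 leNgt r0 in rD.
  have [//|[y Sy]] := TS _ rD TD.
  by rewrite ltNge (ge_inf lbD)//; exists y.
have [_ [y Sy <-]] : exists2 d, D d & d < inf D + (r - inf D).
  by apply: inf_adherent; rewrite // subr_gt0.
by rewrite addrC subrK; exists y.
Qed.

(** Adding finitely many scales to a truncated tenuous set gives a finite member
of TEN R, which is all that is needed to describe X at scales at least r. *)
Definition truncation r T : set K := [set 0] `|` (T `&` [set t | r <= t]).

Lemma TEN_truncation r T F : 0 < r -> TEN R T -> finite_set F -> F `<=` R ->
  TEN R (F `|` truncation r T).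
Proof.
move=> r0 [tT TR T0] finF FR; apply: finite_TEN => //; last by right; left.
  rewrite finite_setU; split => //; rewrite finite_setU; split => //.
  exact: tenuous_finite_ge.
move=> t [/FR//|[->|[/TR//]]]; by have [] := R_range.
Qed.

(** If x and y, null through T and S, were at distance exactly r, then x would
be closer than r to some z in the petal of S, since r is not in T; then z and y
are at distance r inside that petal, although r is not in S. *)
Lemma null_close r x y : 0 < r -> null r x -> null r y ->
  mdist x y <= r -> mdist x y < r.
Proof.
move=> r0 [T [tT Tr Tx]] [S [tS Sr Sy]]; rewrite le_eqVlt => /orP[/eqP xy|//].
have [|z Sz xz] := petal_approach tS tT Tx r0.
  move=> t; rewrite le_eqVlt => /orP[/eqP <- /Tr//|rt _].
  by right; exists y => //; rewrite xy.
exfalso; apply: Sr; rewrite -xy -(ultra_isosceles X_ultra (x := z)).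
  exact: petal_valued.
by rewrite metric_sym xy.
Qed.

(** Every branch meets a petal with a finite range set containing r: truncating
at r the range set of a petal of x, and adding r, leaves only distances less
than r. *)
Lemma branch_center r x : R r -> 0 < r -> exists T y,
  [/\ TEN R T, finite_set T, T r, Pi T y & mdist x y < r].
Proof.
move=> Rr r0; have [T tT Tx] := petal_cover x.
have r_R : [set r] `<=` R by move=> _ ->.
have tT' := TEN_truncation r0 tT (finite_set1 r) r_R.
have [t rt Tt|y Ty xy] := petal_approach tT' tT Tx r0; first by left; right; right.
exists ([set r] `|` truncation r T), y; split => //; last by left.
rewrite !finite_setU; do ![split => //].
by apply: tenuous_finite_ge => //; have [] := tT.
Qed.

(** The distance to the petal of T minus r is 0 or r by (P4), and being null
holds on that petal. The finiteness of T turns this bound on an infimum into one on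
the distance to an actual point. *)
Lemma null_center r T y : 0 < r -> TEN R T -> finite_set T -> T r -> Pi T y ->
  exists2 w, null r w & mdist y w <= r.
Proof.
move=> r0 tT finT Tr Ty; have [d rd Td] := finite_set_gap r finT.
have tT' : TEN R (T `\ r).
  have [_ TR T0] := tT; apply: finite_TEN => //; first exact: finite_setD.
    by move=> t [/TR].
  by split => // /= /eqP; rewrite lt_eqF.
have [|t dt Tt|w T'w yw] := petal_approach tT' tT Ty (r := d).
- exact: lt_trans rd.
- by left; split => //= tr; rewrite tr leNgt rd in dt.
exists w; first by exists (T `\ r); split => // -[_ /=]; exact.
apply: Td yw; apply: petal_valued => //.
by apply: petalS T'w => // t [].
Qed.

(** The numbering is chosen for closed balls as sets, so that it does not depend
on the point that serves as a centre. *)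
Lemma petal_labelling r : R r -> 0 < r -> exists l : X -> nat,
  forall x, branch_labelling r (null r) (cball r x) l.
Proof.
move=> Rr r0.
have /choice[L LP] (C : set X) : exists l,
    (exists x, C = cball r x) -> branch_labelling r (null r) C l.
  have [[x Cx]|] := pselect (exists x, C = cball r x); last by exists (fun=> 0%N).
  have [T [y [tT finT Tr Ty xy]]] := branch_center x Rr r0.
  have {}Cx : C = cball r y by rewrite Cx; apply: cball_eq => //; exact: ltW.
  have [w w0 yw] := null_center r0 tT finT Tr Ty.
  have [U [g [US g_iso gS]]] := petal_urysohn tT.
  have [_ _ T0] := tT.
  have [||||l lP] := @branch_labelling_exists _ _ X_ultra r (null r) C w r0.
  - have [D cD [DT Ddense]] := urysohn_subspace_separable US g_iso gS.
    apply: sub_countable cD.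
    apply: card_le_trans (card_image_le (oball r) _).
    apply: subset_card_le => _ [z Cz <-].
    have [S tS Sz] := petal_cover z.
    have [t rt St|a Ta za] := petal_approach tT tS Sz r0.
      move: rt; rewrite le_eqVlt => /orP[/eqP <-|rt]; first by left.
      right; exists y => //; apply: le_lt_trans rt.
      by rewrite metric_sym; move: Cz; rewrite Cx.
    have [b Db ab] := Ddense a r Ta r0; exists b => //.
    apply/esym/oball_eqP => //; exact: (ultra_lt X_ultra za).
  - apply: infinite_branches => // n.
    have [e [e0 Te er]] := urysohn_subspace_equidistant US g_iso gS n T0 Tr r0 Ty.
    exists e; split => // i; rewrite Cx /cball /= -e0.
    by have [->|/er ->//] := eqVneq ord0 i; rewrite mdistxx ltW.
  - by rewrite Cx.
  - move=> z; rewrite Cx => yz z0; apply: null_close => //.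
    by apply: (ultra_le X_ultra) yw; rewrite metric_sym.
  by exists l.
(* Points of one closed ball consult the same numbering. *)
exists (fun y => L (cball r y) y) => x.
have [] := LP (cball r x) (ex_intro _ x erefl).
have CE y : cball r x y -> cball r y = cball r x.
  by move=> xy; rewrite (cball_eq X_ultra xy).
move=> L1 L2 L3; split.
- by move=> y z xy xz; rewrite !CE//; exact: L1.
- by move=> n; have [z xz <-] := L2 n; exists z; rewrite // CE.
- by move=> y xy; rewrite CE//; exact: L3.
Qed.

End petals.

(** * Coordinates *)

(** The first clause recovers the distance from the coordinates, the second
describes their range by R alone. *)
Definition coding (K : realType) (R : set K) (X : metricType K)
    (Phi : X -> K -> nat) : Prop :=
  (forall x y r, 0 <= r ->
     mdist x y <= r <-> forall t, r < t -> Phi x t = Phi y t) /\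
  (forall f : K -> nat, (exists x, Phi x = f) <->
     exists2 T, TEN R T & forall t, f t != 0%N -> T t /\ 0 < t).

Lemma coding_isometric (K : realType) (R : set K) (X Y : metricType K)
    (Phi : X -> K -> nat) (Psi : Y -> K -> nat) :
  coding R Phi -> coding R Psi -> isometric X Y.
Proof.
move=> [PhiE PhiR] [PsiE PsiR].
have /choice[f fE] (x : X) : exists y, Psi y = Phi x.
  by apply/PsiR/PhiR; exists x.
have /choice[g gE] (y : Y) : exists x, Phi x = Psi y.
  by apply/PhiR/PsiR; exists y.
have f_iso : isometric_embedding f.
  move=> x y; apply/eqP; rewrite eq_le; apply/andP; split.
  - by apply/PsiE; rewrite ?mdist_ge0// !fE; apply/PhiE; rewrite ?mdist_ge0.
  - by apply/PhiE; rewrite ?mdist_ge0// -!fE; apply/PsiE; rewrite ?mdist_ge0.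
exists f => //; exists g => [x|y]; apply: mdist_positivity; apply/eqP;
  rewrite eq_le mdist_ge0 andbT.
- by apply/PhiE => // t _; rewrite gE fE.
- by apply/PsiE => // t _; rewrite fE gE.
Qed.

(** * The numberings of branches are coordinates *)

Section petaloid_coding.
Context {K : realType} {R : set K} (R_range : range_set R) {X : metricType K}.
Context (X_ultra : ultrametric X) (X_valued : valued_in R X).
Context (Pi : set K -> set X) (Pi_petal : petal R Pi).
Context (Phi : X -> K -> nat).
Context (PhiL : forall t, R t -> 0 < t -> forall x,
  branch_labelling t (null R Pi t) (cball t x) (Phi^~ t)).
Context (Phi0 : forall t x, ~ (R t /\ 0 < t) -> Phi x t = 0%N).
Implicit Types (S T : set K) (x y z : X) (r t : K).

Let Phi_eq x y t : mdist x y < t -> Phi x t = Phi y t.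
Proof.
move=> xyt; have t0 : 0 < t by exact: le_lt_trans (mdist_ge0 x y) xyt.
have [Rt|nRt] := pselect (R t); last by rewrite !Phi0// => -[].
have [H _ _] := PhiL Rt t0 x.
by apply/H; rewrite /cball /= ?mdistxx // ltW.
Qed.

Let Phi_dist x y r : 0 <= r ->
  mdist x y <= r <-> forall t, r < t -> Phi x t = Phi y t.
Proof.
move=> r0; split => [xyr t rt|xyE].
  by apply: Phi_eq; exact: le_lt_trans rt.
rewrite leNgt; apply/negP => rxy; have d0 := le_lt_trans r0 rxy.
have [H _ _] := PhiL (X_valued x y) d0 x.
have /H : Phi x (mdist x y) = Phi y (mdist x y) by exact: xyE.
by rewrite /cball /= mdistxx lexx ltxx => /(_ (ltW d0) isT).
Qed.

Let Phi_supp T x t : TEN R T -> Pi T x -> Phi x t != 0%N -> T t /\ 0 < t.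
Proof.
move=> tT Tx; apply: contra_neqP => nTt.
have [[Rt t0]|/Phi0 //] := pselect (R t /\ 0 < t).
have [_ _ H] := PhiL Rt t0 x; apply: H; first by rewrite /cball /= mdistxx ltW.
by exists T; split => // Tt; exact: nTt.
Qed.

Let TEN_seq (s : seq K) : [set` s] `<=` R -> TEN R ([set 0] `|` [set` s]).
Proof.
move=> sR; apply: finite_TEN => //; last by left.
  by rewrite finite_setU.
by move=> t [->|/sR//]; have [] := R_range.
Qed.

(** The seq is sorted so that its head a is the smallest scale: the point found
for the tail is moved by at most a, which leaves its values at the larger
scales unchanged. *)
Let Phi_finite (f : K -> nat) (s : seq K) : sorted <%R s ->
  [set` s] `<=` R -> (forall t, t \in s -> 0 < t) ->
  exists2 x, Pi ([set 0] `|` [set` s]) x & forall t, t \in s -> Phi x t = f t.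
Proof.
elim: s => [|a s IHs] sorts sR s0.
  have [x Sx] : Pi ([set 0] `|` [set` [::]]) !=set0.
    by apply: (petal_neq0 Pi_petal); exact: TEN_seq.
  by exists x.
have a0 : 0 < a by apply: s0; rewrite mem_head.
have Ra : R a by apply: sR; rewrite /= mem_head.
have ssR : [set` s] `<=` R by move=> t ts; apply: sR; rewrite /= inE ts orbT.
have as_lt t : t \in s -> a < t.
  by move=> ts; have /allP := order_path_min lt_trans sorts; exact.
have [||x Sx xf] := IHs _ ssR; first exact: path_sorted sorts.
  by move=> t ts; apply: s0; rewrite inE ts orbT.
have [_ H _] := PhiL Ra a0 x; have [y xy ya] := H (f a).
have [T tT Ty] := petal_cover Pi_petal y.
have tS := TEN_seq ssR; have tS' := TEN_seq sR.
have S'x : Pi ([set 0] `|` [set` a :: s]) x.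
  apply: (petalS Pi_petal) Sx => //; apply: setUS => t /= ts.
  by rewrite inE ts orbT.
(* The point y has the right value at a but may lie in a large petal; z is in
   the same branch as y and in the petal of a :: s. *)
have [t|z Sz yz] := petal_approach Pi_petal tS' tT Ty a0.
  rewrite le_eqVlt => /orP[/eqP <- _|lt_at _].
    by left; right; rewrite /= mem_head.
  by right; exists x => //; rewrite metric_sym (le_lt_trans xy).
exists z => // t; rewrite inE => /orP[/eqP ->|ts].
  by rewrite -ya; apply: Phi_eq; rewrite metric_sym.
rewrite -xf//; apply: Phi_eq; apply: le_lt_trans (as_lt t ts).
by rewrite metric_sym (ultra_le X_ultra xy)// ltW.
Qed.

Let Phi_approx (f : K -> nat) T r : TEN R T -> 0 < r ->
  (forall t, f t != 0%N -> T t /\ 0 < t) ->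
  exists2 x, Pi T x & forall t, r <= t -> Phi x t = f t.
Proof.
move=> tT r0 fT; have [tT' TR T0] := tT.
have /finite_seqP[s0 s0E] := tenuous_finite_ge tT' r0.
(* An increasing enumeration of the part of T at or above r. *)
pose s := sort <=%R (undup s0).
have sE t : t \in s <-> T t /\ r <= t.
  by rewrite mem_sort mem_undup; have := congr1 (@^~ t) s0E => /= <-.
have [||t /sE[_]|x Sx xf] := @Phi_finite f s.
- by rewrite sort_lt_sorted undup_uniq.
- by move=> t /sE[/TR].
- exact: lt_le_trans.
have tS : TEN R ([set 0] `|` [set` s]) by apply: TEN_seq => t /sE[/TR].
exists x.
  by apply: (petalS Pi_petal) Sx => // t [->//|/sE[]].
move=> t rt; have [/xf//|ts] := boolP (t \in s).
have nTt : ~ T t by move=> Tt; move/negP: ts; apply; exact/sE.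
transitivity 0%N.
  apply/eqP/negPn/negP => /(Phi_supp tS Sx)[[t0|/= ts' _]].
    by rewrite t0 ltxx.
  by rewrite ts' in ts.
by apply/esym/eqP/negPn/negP => /fT[].
Qed.

Let Phi_range (f : K -> nat) : (exists x, Phi x = f) <->
  exists2 T, TEN R T & forall t, f t != 0%N -> T t /\ 0 < t.
Proof.
split=> [[x <-]|[T tT fT]].
  by have [T tT Tx] := petal_cover Pi_petal x; exists T => // t; exact: Phi_supp.
have /choice[u uP] (n : nat) : exists x, Pi T x /\
    forall t, n.+1%:R^-1 <= t -> Phi x t = f t.
  by have [|x Tx xf] := @Phi_approx f T n.+1%:R^-1 tT _ fT; [|exists x].
have [|n m nm|x Tx ux] := petal_complete Pi_petal tT (u := u).
- by move=> n; have [] := uP n.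
- apply/Phi_dist => // t nt; rewrite (uP n).2 ?(uP m).2 ?ltW//.
  by apply: le_lt_trans nt; rewrite lef_pV2 ?posrE// ler_nat.
exists x; apply/funext => t; have [t0|t0] := ltP 0 t; last first.
  rewrite Phi0; last by move=> [_]; rewrite ltNge t0.
  by apply/esym/eqP/negPn/negP => /fT[_]; rewrite ltNge t0.
have [n] := ltr_add_invr t0; rewrite add0r => nt.
rewrite -(uP n).2 ?ltW//; apply: Phi_eq.
by rewrite metric_sym; exact: le_lt_trans nt.
Qed.

Lemma labelling_coding : coding R Phi.
Proof. by split; [exact: Phi_dist|exact: Phi_range]. Qed.

End petaloid_coding.

Lemma petaloid_coding (K : realType) (R : set K) (X : metricType K) :
  range_set R -> petaloid R X -> exists Phi : X -> K -> nat, coding R Phi.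
Proof.
move=> R_range [X_ultra X_valued [Pi Pi_petal]].
have /choice[L LP] (t : K) : exists l : X -> nat,
    (R t -> 0 < t -> forall x, branch_labelling t (null R Pi t) (cball t x) l) /\
    (~ (R t /\ 0 < t) -> forall x, l x = 0%N).
  have [[Rt t0]|nt] := pselect (R t /\ 0 < t); last first.
    by exists (fun=> 0%N); split=> // Rt t0; case: nt.
  have [l lP] := petal_labelling R_range X_ultra Pi_petal Rt t0.
  by exists l; split => // -[].
exists (fun x t => L t x); apply: (labelling_coding R_range X_ultra X_valued Pi_petal).
- by move=> t; exact: (LP t).1.
- by move=> t x nt; exact: (LP t).2.
Qed.

Theorem theorem1p1 (K : realType) (R : set K)
  (R_range : range_set R) (R_uncountable : ~ countable R)
  (X Y : metricType K) (X_petaloid : petaloid R X) (Y_petaloid : petaloid R Y) :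
  isometric X Y.
Proof.
have [Phi PhiP] := petaloid_coding R_range X_petaloid.
have [Psi PsiP] := petaloid_coding R_range Y_petaloid.
exact: coding_isometric PhiP PsiP.
Qed.
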